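(* Let $k\ge s\ge1$ and $n\ge0$. For $i\in[s]$ let $Z_i\subseteq[n]$ and $\tau_i\ge0$ with $|Z_i|+\tau_i\le k-1$, and let $f_i=\mathsf f(Z_i,\tau_i)$. Then the following are equivalent: (i) for all $g_1,\dots,g_s\in R_n[X;\sigma]$ with $\deg(g_if_i)\le k-1$ for all $i$, $\sum_{i=1}^s g_if_i=0$ implies $g_1=\dots=g_s=0$; (ii) for every nonempty $\Omega\subseteq[s]$, $$k-\Big|\bigcap_{i\in\Omega}Z_i\Big|-\min_{i\in\Omega}\tau_i\ \ge\ \sum_{i\in\Omega}\big(k-\tau_i-|Z_i|\big).$$
   Context: Fix a prime power $q$, integer $m$, an ordered partition $(n_1,\dots,n_\ell)$ of $n$, and $a_1,\dots,a_\ell\in\mathbb F_{q^m}^*$ lying in pairwise distinct $\sigma$-conjugacy classes of $\mathbb F_{q^m}$ ($a\sim b$ iff $b=ac^{q-1}$ for some $c\ne0$). Let $R_n=\mathbb F_{q^m}[\beta_{1,1},\dots,\beta_{1,n_1},\dots,\beta_{\ell,1},\dots,\beta_{\ell,n_\ell}]$ be the commutative polynomial ring in $n$ indeterminates, with $\sigma(a)=a^q$ on $R_n$. $R_n[X;\sigma]$ is the skew polynomial ring with $Xa=a^qX$ for $a\in R_n$. Index $j\in[n]$ corresponds to $(l,t)$ via $j=t+\sum_{r<l}n_r$, and we set $\alpha_j=a_l\beta_{l,t}^{q-1}$. For $Z\subseteq[n]$ and $\tau\ge0$, $\mathsf f(Z,\tau)=X^\tau\cdot f_Z$, where $f_Z$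 is the monic least common left multiple of $\{X-\alpha_j: j\in Z\}$ computed in the skew polynomial ring over the fraction field of $R_n$ ($f_\emptyset=1$); it has coefficients in $R_n$ and degree $|Z|$ (it can be built by $g\mapsto (X-g(\alpha_j)^{q-1}\alpha_j)g$, where $g(\alpha)=\sum_i g_i\alpha^{(q^i-1)/(q-1)}$). *)

(* Defs.v *)
From HB Require Import structures.
From mathcomp Require Import all_boot all_order all_algebra all_field.
From mathcomp Require Import fraction.
From mathcomp Require Export mpoly.

Set Implicit Arguments.
Unset Strict Implicit.
Unset Printing Implicit Defensive.

Import Order.TTheory GRing.Theory.
Local Open Scope ring_scope.

(* Skew polynomials R[X; sigma] over a commutative ring R with an      *)
(* endomorphism sigma.  The carrier is {poly R} (coefficient lists,    *)
(* addition, zero and degree as usual); only the multiplication is    *)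
(* twisted:  (a X^i) * (b X^j) = a sigma^i(b) X^(i+j).                 *)
Definition skmul (R : comRingType) (sigma : R -> R) (p r : {poly R}) : {poly R} :=
  \sum_(i < size p) \sum_(j < size r)
     (p`_i * iter i sigma r`_j) *: 'X^(i + j).

Definition skrdvd (R : comRingType) (sigma : R -> R) (d h : {poly R}) : Prop :=
  exists u : {poly R}, h = skmul sigma u d.

Definition prime_power (q : nat) : Prop :=
  exists p e : nat, prime p /\ q = (p ^ e.+1)%N.

Notation Rn F ns := {mpoly F[sumn ns]}.
Notation FracRn F ns := {fraction {mpoly F[sumn ns]}}.

(* block index l(j) of the variable j under the ordered partition ns:  *)
(* the least l with j < n_1 + ... + n_(l+1)  (0-based).                  *)
Definition blk (ns : seq nat) (j : nat) : nat :=
  find (fun l => (j < sumn (take l.+1 ns))%N) (iota 0 (size ns)).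

Definition alpha (F : finFieldType) (q : nat) (ns : seq nat) (a : seq F)
    (j : 'I_(sumn ns)) : Rn F ns :=
  (nth 0 a (blk ns j)) *: ('X_j ^+ (q - 1)).

Definition sconj (F : finFieldType) (q : nat) (x y : F) : Prop :=
  exists2 c : F, c != 0 & y = x * c ^+ (q - 1).

(* f is (the R_n-coefficient version of) the monic least common left     *)
(* multiple of {X - alpha_j : j in Z}, computed in the skew polynomial    *)
(* ring over the fraction field of R_n (sigma = q-Frobenius there).        *)
Definition is_fZ (F : finFieldType) (q : nat) (ns : seq nat) (a : seq F)
    (Z : {set 'I_(sumn ns)}) (f : {poly Rn F ns}) : Prop :=
  let sig := fun x : FracRn F ns => x ^+ q in
  let fK := map_poly (@tofrac _) f in
  let lin j := 'X - (tofrac (alpha q a j))%:P : {poly FracRn F ns} in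
  [/\ fK \is monic,
      (forall j, j \in Z -> skrdvd sig (lin j) fK) &
      (forall h : {poly FracRn F ns},
          (forall j, j \in Z -> skrdvd sig (lin j) h) -> skrdvd sig fK h)].

(* Main.v *)
Require Import Defs.
From HB Require Import structures.
From mathcomp Require Import all_boot all_order all_algebra all_field.
From mathcomp Require Import fraction mpoly zify.

(* Condition (i) says that the shifts X^d f_i, d < k - tau_i - |Z_i|, are linearly
   independent, that is, that their coefficient matrix has a nonzero maximal minor.

   (i) => (ii): for i in Omega all these vectors are left multiples, of degree
   below k, of X^t f_W with W the intersection of the Z_i and t the minimum of the
   tau_i, and such multiples span a space of dimension k - |W| - t.

   (ii) => (i): induction on k + s + sum |Z_i|.
   - If (ii) is an equality for some Omega with 1 < |Omega| < s, the block Omega is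
     replaced by the single pair (W, t).
   - If every tau_i is positive, X cancels on the right since
     X^(tau+1) f = sigma(X^tau f) X; independence passes to sigma-images because
     sigma is injective on minors.
   - If tau_i = 0 and some variable beta_j with j outside Z_i occurs, put beta_j = 0:
     this turns (Z, tau) into (Z minus j, tau + 1) when j is in Z, preserves (ii) in
     the absence of tight proper blocks, and a minor that survives the
     specialisation was nonzero.
   - Otherwise exactly one tau_i vanishes and Z_i contains all the others; since f_Z
     has nonzero constant term, X divides g_i on the right and k decreases. *)

Set Implicit Arguments.
Unset Strict Implicit.
Unset Printing Implicit Defensive.

Import Order.TTheory GRing.Theory.
Local Open Scope ring_scope.

(** * Skew polynomials acting on semilinear modules *)

Section SemilinearAction.

Variables (R : comNzRingType) (sg : {rmorphism R -> R}).
Implicit Types p r t d : {poly R}.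

Definition semilin (V : lmodType R) (T : V -> V) :=
  (forall u v, T (u + v) = T u + T v) /\ (forall c v, T (c *: v) = sg c *: T v).

(** A semilinear [T] makes [V] a left module over the skew polynomial ring, with X acting as [T].
    Taking [T] to be [skX] gives multiplication, and taking it to be z |-> a sg(z) gives
    evaluation. *)
Definition skact (V : lmodType R) (T : V -> V) (p : {poly R}) (v : V) : V :=
  \sum_(i < size p) p`_i *: iter i T v.

Section Module.

Variables (V : lmodType R) (T : V -> V).
Hypothesis sT : semilin T.

Lemma semilin0 : T 0 = 0.
Proof. by have := sT.2 0 0; rewrite scale0r rmorph0 scale0r. Qed.

Lemma semilin_sum (I : Type) (r : seq I) (P : pred I) (F : I -> V) :
  T (\sum_(i <- r | P i) F i) = \sum_(i <- r | P i) T (F i).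
Proof. exact: (big_morph T sT.1 semilin0). Qed.

Lemma skactE n p v : (size p <= n)%N ->
  skact T p v = \sum_(i < n) p`_i *: iter i T v.
Proof.
move=> le_pn; rewrite /skact (big_ord_widen n (fun i => p`_i *: iter i T v)) //.
rewrite [RHS](bigID (fun i : 'I_n => (i < size p)%N)) /= [X in _ = _ + X]big1 ?addr0 //.
by move=> i; rewrite -leqNgt => le_pi; rewrite nth_default // scale0r.
Qed.

Lemma skactDl p r v : skact T (p + r) v = skact T p v + skact T r v.
Proof.
set n := maxn (size p) (size r).
rewrite (@skactE n) ?(leq_trans (size_polyD _ _)) //.
rewrite (@skactE n p) ?leq_maxl // (@skactE n r) ?leq_maxr //.
by rewrite -big_split; apply: eq_bigr => i _; rewrite coefD scalerDl.
Qed.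

Lemma skactZl c p v : skact T (c *: p) v = c *: skact T p v.
Proof.
rewrite (@skactE (size p)) ?size_scale_leq // /skact scaler_sumr.
by apply: eq_bigr => i _; rewrite coefZ scalerA.
Qed.

Lemma skact0l v : skact T 0 v = 0.
Proof. by rewrite /skact size_poly0 big_ord0. Qed.

Lemma skactBl p r v : skact T (p - r) v = skact T p v - skact T r v.
Proof. by rewrite skactDl -[- r]scaleN1r skactZl scaleN1r. Qed.

Lemma skact_suml (I : Type) (s : seq I) (P : pred I) (F : I -> {poly R}) v :
  skact T (\sum_(i <- s | P i) F i) v = \sum_(i <- s | P i) skact T (F i) v.
Proof.
by apply: (big_morph (fun p => skact T p v)) => [p r|]; rewrite ?skactDl ?skact0l.
Qed.

Lemma skactXn n v : skact T 'X^n v = iter n T v.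
Proof.
rewrite /skact size_polyXn big_ord_recr /= big1 ?add0r.
  by rewrite coefXn eqxx scale1r.
by move=> i _; rewrite coefXn ltn_eqF // scale0r.
Qed.

Lemma skactC c v : skact T c%:P v = c *: v.
Proof. by rewrite -[c%:P]mulr1 mul_polyC skactZl -(expr0 'X) skactXn. Qed.

Lemma skact0r p : skact T p 0 = 0.
Proof.
rewrite /skact big1 // => i _.
by rewrite iter_fix ?semilin0 ?scaler0.
Qed.

End Module.

(* Left multiplication by the indeterminate of R[X; sg], since X a = sg(a) X. *)
Definition skX (p : {poly R}) : {poly R} := map_poly sg p * 'X.

Lemma semilin_skX : semilin skX.
Proof.
split=> [p r|c p]; rewrite /skX.
  by rewrite rmorphD mulrDl.
by rewrite map_polyZ scalerAl.
Qed.

Lemma coef_skX p i : (skX p)`_i = if i is i'.+1 then sg p`_i' else 0.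
Proof. by rewrite /skX coefMX coef_map; case: i. Qed.

Lemma skXXn n : skX 'X^n = 'X^(n.+1).
Proof. by rewrite /skX map_polyXn exprSr. Qed.

Lemma iter_skXE i r :
  iter i skX r = \sum_(j < size r) iter i sg r`_j *: 'X^(i + j).
Proof.
elim: i => [|i IHi] /=; first by rewrite -[LHS]coefK poly_def.
rewrite IHi (semilin_sum semilin_skX); apply: eq_bigr => j _.
by rewrite semilin_skX.2 skXXn.
Qed.

(** The ring acts on itself from the left, so [skact_mul] yields both associativity and the product
    rule for evaluation. *)
Lemma skmulE p r : skmul sg p r = skact skX p r.
Proof.
apply: eq_bigr => i _; rewrite iter_skXE scaler_sumr.
by apply: eq_bigr => j _; rewrite scalerA.
Qed.

Lemma skact_skX (V : lmodType R) (T : V -> V) (sT : semilin T) p v :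
  skact T (skX p) v = T (skact T p v).
Proof.
rewrite [in LHS](_ : p = \sum_(i < size p) p`_i *: 'X^i); last first.
  by rewrite -[LHS]coefK poly_def.
rewrite (semilin_sum semilin_skX) skact_suml (semilin_sum sT).
by apply: eq_bigr => i _; rewrite semilin_skX.2 skXXn skactZl skactXn iterS sT.2.
Qed.

Lemma skact_iter_skX (V : lmodType R) (T : V -> V) (sT : semilin T) n p v :
  skact T (iter n skX p) v = iter n T (skact T p v).
Proof. by elim: n => //= n IHn; rewrite skact_skX // IHn. Qed.

Lemma skact_mul (V : lmodType R) (T : V -> V) (sT : semilin T) p r v :
  skact T (skmul sg p r) v = skact T p (skact T r v).
Proof.
rewrite skmulE /skact -/(skact T _ v) skact_suml.
by apply: eq_bigr => i _; rewrite skactZl skact_iter_skX.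
Qed.

Local Notation "p ** r" := (skmul sg p r) (at level 40, left associativity).

Lemma skmulA p r t : p ** (r ** t) = p ** r ** t.
Proof. by rewrite [RHS]skmulE (skact_mul semilin_skX) -!skmulE. Qed.

Lemma skmulDl p r t : (p + r) ** t = p ** t + r ** t.
Proof. by rewrite !skmulE skactDl. Qed.

Lemma skmulBl p r t : (p - r) ** t = p ** t - r ** t.
Proof. by rewrite !skmulE skactBl. Qed.

Lemma skmulZl c p r : (c *: p) ** r = c *: (p ** r).
Proof. by rewrite !skmulE skactZl. Qed.

Lemma skmul0l p : 0 ** p = 0.
Proof. by rewrite skmulE skact0l. Qed.

Lemma skmulCl c p : c%:P ** p = c *: p.
Proof. by rewrite skmulE skactC. Qed.

Lemma skmulXnl n p : 'X^n ** p = iter n skX p.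
Proof. by rewrite skmulE skactXn. Qed.

Lemma skmulXl p : 'X ** p = skX p.
Proof. by rewrite -['X]expr1 skmulXnl. Qed.

Lemma skmulX p : p ** 'X = p * 'X.
Proof.
rewrite -[in RHS](coefK p) poly_def mulr_suml skmulE; apply: eq_bigr => i _.
rewrite -scalerAl -exprSr; congr (_ *: _); elim: (i : nat) => //= n ->.
exact: skXXn.
Qed.

Lemma skmulXn p n : p ** 'X^n = p * 'X^n.
Proof.
elim: n => [|n IHn]; last by rewrite exprSr -[in LHS]skmulX skmulA IHn skmulX mulrA.
rewrite expr0 mulr1 skmulE -[RHS](coefK p) poly_def; apply: eq_bigr => i _.
rewrite -(expr0 'X); congr (_ *: _).
by elim: (i : nat) => //= n ->; rewrite skXXn.
Qed.

Lemma skmul_suml (I : Type) (s : seq I) (P : pred I) (F : I -> {poly R}) r :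
  (\sum_(i <- s | P i) F i) ** r = \sum_(i <- s | P i) (F i ** r).
Proof. by rewrite skmulE skact_suml; apply: eq_bigr => i _; rewrite skmulE. Qed.

Lemma skmul_def n p r : (size p <= n)%N ->
  p ** r = \sum_(i < n) p`_i *: iter i skX r.
Proof. by move=> le_pn; rewrite skmulE (skactE _ _ le_pn). Qed.

Lemma skX_map p : skX p = map_poly sg p ** 'X.
Proof. by rewrite skmulX. Qed.

Lemma skX_mul p r : skX (p ** r) = map_poly sg p ** skX r.
Proof. by rewrite -skmulXl skmulA skmulXl skX_map -skmulA skmulXl. Qed.

Lemma skX_monic p : p \is monic -> skX p \is monic.
Proof. by move=> mp; rewrite monicMr ?monicX // monic_map. Qed.

Lemma size_skX p : p \is monic -> size (skX p) = (size p).+1.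
Proof.
move=> mp; rewrite size_mulX ?monic_neq0 ?monic_map //.
by rewrite size_map_poly_id0 // (monicP mp) rmorph1 oner_neq0.
Qed.

Lemma iter_skX_monic n p : p \is monic ->
  iter n skX p \is monic /\ size (iter n skX p) = (n + size p)%N.
Proof.
move=> mp; elim: n => [|n [IH1 IH2]] //=.
by rewrite skX_monic // size_skX // IH2.
Qed.

(** Since [r] is monic, each X^i r is monic of degree i + deg r. The top term of [p] therefore
    cannot cancel, and its coefficient is not twisted. *)
Lemma skmul_lead p r : r \is monic -> p != 0 ->
  size (p ** r) = (size p + size r).-1 /\ lead_coef (p ** r) = lead_coef p.
Proof.
move=> mr p0; have sp : (0 < size p)%N by rewrite size_poly_gt0.
have sr : (0 < size r)%N by rewrite size_poly_gt0 monic_neq0.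
rewrite skmulE /skact -(prednK sp) big_ord_recr /=.
set n := (size p).-1; have [mn szn] := iter_skX_monic n mr.
have lp : p`_n != 0 by rewrite -lead_coefE lead_coef_eq0.
have sl : size (p`_n *: iter n skX r) = (n + size r)%N.
  by rewrite -mul_polyC size_Mmonic ?polyC_eq0 // size_polyC lp szn.
have lt : (size (\sum_(i < n) p`_i *: iter i skX r)%R < n + size r)%N.
  rewrite (@leq_ltn_trans (n + size r).-1) ?prednK ?addn_gt0 ?sr ?orbT //.
  apply: (leq_trans (size_sum _ _ _)); apply/bigmax_leqP => i _.
  apply: (leq_trans (size_scale_leq _ _)).
  have [_ ->] := iter_skX_monic i mr; have := ltn_ord i; lia.
rewrite addrC size_polyDl ?sl // lead_coefDl ?sl //; split=> //.
by rewrite -mul_polyC lead_coef_Mmonic // lead_coefC.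
Qed.

Lemma skmul_monic p r : r \is monic -> p \is monic -> p ** r \is monic.
Proof.
move=> mr mp; have [_] := skmul_lead mr (monic_neq0 mp).
by rewrite (monicP mp) => /eqP.
Qed.

Lemma size_skmul_leq p r n : r \is monic -> (0 < n)%N ->
  (size (p ** r) <= n)%N = (size p <= n.+1 - size r)%N.
Proof.
move=> mr n0; have [->|p0] := eqVneq p 0; first by rewrite skmul0l size_poly0.
have [-> _] := skmul_lead mr p0.
have := size_poly_gt0 p; have := size_poly_gt0 r; rewrite p0 monic_neq0 //; lia.
Qed.

Lemma skdivP d p : d \is monic ->
  exists u r, p = u ** d + r /\ (size r < size d)%N.
Proof.
move=> md; have [n] := ubnP (size p); elim: n p => // n IHn p lt_pn.
have [lt_pd|le_dp] := ltnP (size p) (size d); first by exists 0, p; rewrite skmul0l add0r.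
set t := lead_coef p *: 'X^(size p - size d).
have sd : (0 < size d)%N by rewrite size_poly_gt0 monic_neq0.
have [|u [r [e lt_r]]] := IHn (p - t ** d).
  rewrite (leq_trans _ (ltnSE lt_pn)) //.
  rewrite skmulZl skmulXnl; have [mi si] := iter_skX_monic (size p - size d) md.
  rewrite subnK // in si.
  have sp : (0 < size p)%N by rewrite (leq_trans sd).
  rewrite -[X in (_ < X)%N](prednK sp) ltnS; apply/leq_sizeP => i le_i.
  rewrite coefB coefZ; have [e|ne] := eqVneq i (size p).-1.
    by have := monicP mi; rewrite lead_coefE si -e => ->; rewrite mulr1 e -lead_coefE subrr.
  have le_pi : (size p <= i)%N by rewrite -(prednK sp) ltn_neqAle eq_sym ne.
  by rewrite !nth_default ?si ?mulr0 ?subr0.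
by exists (t + u), r; rewrite skmulDl -addrA -e addrC subrK.
Qed.

(** Degrees force the cofactor [u] to be a constant, and leading coefficients force it to be 1. This
    gives uniqueness of least common left multiples. *)
Lemma rdvd_monic_anti p r u v : p \is monic -> r \is monic ->
  p = u ** r -> r = v ** p -> p = r.
Proof.
move=> mp mr ep er.
have u0 : u != 0.
  by apply: contraTneq mp => u0; rewrite ep u0 skmul0l monicE lead_coef0 eq_sym oner_neq0.
have v0 : v != 0.
  by apply: contraTneq mr => v0; rewrite er v0 skmul0l monicE lead_coef0 eq_sym oner_neq0.
have [su lu] := skmul_lead mr u0; have [sv _] := skmul_lead mp v0.
rewrite -ep (monicP mp) in lu; rewrite -ep in su; rewrite -er in sv.
have := size_poly_gt0 u; have := size_poly_gt0 v; rewrite u0 v0 => gv gu.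
have gr := size_poly_gt0 r; rewrite monic_neq0 // in gr.
have gp := size_poly_gt0 p; rewrite monic_neq0 // in gp.
have s1 : (size u <= 1)%N.
  by move: su sv gv gu gr gp; move: (size u) (size v) (size r) (size p) => ? ? ? ?; lia.
have eu := size1_polyC s1; rewrite eu lead_coefC in lu.
by rewrite ep eu -lu skmulCl scale1r.
Qed.

End SemilinearAction.

(** * The q-Frobenius endomorphism *)

Section FrobeniusPower.

Variables (R : comNzRingType) (p e : nat) (charRp : p \in [pchar R]).

(* The proof [charRp] is a parameter so that [frobq] is canonically a morphism. *)
Definition frobq (x : R) : R := let _ := charRp in x ^+ (p ^ e).

Fact frobq_zmod_morphism : zmod_morphism frobq.
Proof.
move=> x y; rewrite /frobq; elim: e => [|n IHn]; first by rewrite !expn0 !expr1.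
by rewrite expnSr !exprM IHn -!(pFrobenius_autE charRp) rmorphB.
Qed.

Fact frobq_monoid_morphism : monoid_morphism frobq.
Proof. by split=> [|x y]; rewrite /frobq ?expr1n ?exprMn. Qed.

HB.instance Definition _ := GRing.isZmodMorphism.Build R R frobq frobq_zmod_morphism.
HB.instance Definition _ := GRing.isMonoidMorphism.Build R R frobq frobq_monoid_morphism.

End FrobeniusPower.

(** * Least common left multiples *)

Section Lclm.

Variables (R : comNzRingType) (q : nat) (sg : {rmorphism R -> R}).
Hypotheses (q_gt0 : (0 < q)%N) (sgE : forall x, sg x = x ^+ q).
Implicit Types (a y : R) (p h : {poly R}) (s : seq (R * R)).

Local Notation "p ** r" := (skmul sg p r) (at level 40, left associativity).

(* The right root condition h(a y^(q-1)) = 0 is linearised: R is a module over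
   R[X; sg] with X acting as y |-> a sg(y), and h(a y^(q-1)) y is the value of h
   on y. *)
Definition skev a p y : R := @skact R R^o (fun z : R => a * sg z) p y.

Lemma semilin_skev a : @semilin R sg R^o (fun z : R => a * sg z).
Proof.
by split=> [u v|c v]; rewrite ?rmorphD ?mulrDr // rmorphM mulrCA.
Qed.

Lemma skev_mul a p r y : skev a (p ** r) y = skev a p (skev a r y).
Proof. exact: (skact_mul (semilin_skev a)). Qed.

Lemma skev0 a p : skev a p 0 = 0.
Proof. exact: (skact0r (semilin_skev a)). Qed.

Lemma skevD a p r y : skev a (p + r) y = skev a p y + skev a r y.
Proof. by rewrite /skev skactDl. Qed.

Lemma skevC a c y : skev a c%:P y = c * y.
Proof. by rewrite /skev skactC. Qed.

Lemma skevXsubC a c y : skev a ('X - c%:P) y = a * sg y - c * y.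
Proof.
by rewrite /skev skactBl -['X]expr1 skactXn skactC.
Qed.

Lemma skev_lin a y : skev a ('X - (a * y ^+ (q - 1))%:P) y = 0.
Proof. by rewrite skevXsubC sgE -mulrA -exprSr subn1 prednK // subrr. Qed.

(** A pair (a, y) encodes the point α = a y^(q-1). As [skev a f y] is f(α) y, the subtracted
    constant is f(α)^(q-1) α, so this is the recursion g |-> (X - g(α)^(q-1) α) g. *)
Definition lclm s : {poly R} :=
  foldr (fun b f => ('X - (b.1 * skev b.1 f b.2 ^+ (q - 1))%:P) ** f) 1 s.

(** P-independence of the points: none is a right root of the multiple built from those after it. *)
Fixpoint pindep s : bool :=
  if s is b :: s' then (skev b.1 (lclm s') b.2 != 0) && pindep s' else true.

Lemma lclm_monic s : lclm s \is monic.
Proof. by elim: s => [|b s IHs]; rewrite ?monic1 // skmul_monic ?monicXsubC. Qed.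

Lemma size_lclm s : size (lclm s) = (size s).+1.
Proof.
elim: s => [|b s IHs]; first by rewrite size_poly1.
have [/= -> _] := skmul_lead sg (lclm_monic s) (monic_neq0 (monicXsubC
   (b.1 * skev b.1 (lclm s) b.2 ^+ (q - 1)))).
by rewrite size_XsubC IHs.
Qed.

Lemma lclm_root s b : b \in s -> skev b.1 (lclm s) b.2 = 0.
Proof.
elim: s => // c s IHs; rewrite inE /= skev_mul => /predU1P[->|/IHs ->].
  exact: skev_lin.
exact: skev0.
Qed.

End Lclm.

Section LclmUniversal.

Variables (R : idomainType) (q : nat) (sg : {rmorphism R -> R}).
Hypotheses (q_gt0 : (0 < q)%N) (sgE : forall x, sg x = x ^+ q).
Implicit Types (a y : R) (p h : {poly R}) (s : seq (R * R)).

Local Notation "p ** r" := (skmul sg p r) (at level 40, left associativity).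
Local Notation skev := (skev sg).
Local Notation lclm := (lclm q sg).
Local Notation pindep := (pindep q sg).

Lemma skrdvd_linP a y h : y != 0 -> skev a h y = 0 ->
  exists u, h = u ** ('X - (a * y ^+ (q - 1))%:P).
Proof.
move=> y0 hy; have md := monicXsubC (a * y ^+ (q - 1)).
have [u [r [e]]] := skdivP sg h md; rewrite size_XsubC ltnS => /size1_polyC er.
exists u; move: hy; rewrite e skevD skev_mul skev_lin // skev0 add0r er skevC.
by move/eqP; rewrite mulf_eq0 (negPf y0) orbF => /eqP ->; rewrite addr0.
Qed.

(** If h = u g, with g the multiple of the tail, then u vanishes at the value of g at the new point.
    P-independence makes that value nonzero, so the new linear factor divides u on the right. *)
Lemma lclm_rdvd s h : pindep s -> (forall b, b \in s -> skev b.1 h b.2 = 0) ->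
  exists u, h = u ** lclm s.
Proof.
elim: s => [|b s IHs] /=.
  by move=> _ _; exists h; rewrite -(expr0 'X) skmulXn expr0 mulr1.
case/andP=> y0 pis hs; have [|u eu] := IHs pis.
  by move=> c cs; apply: hs; rewrite inE cs orbT.
have := hs b (mem_head _ _); rewrite eu skev_mul => uy.
by have [v ->] := skrdvd_linP y0 uy; exists v; rewrite skmulA.
Qed.

Lemma lclm_perm s s' : pindep s -> pindep s' -> s =i s' -> lclm s = lclm s'.
Proof.
move=> ps ps' ess'.
have [|u eu] := @lclm_rdvd s' (lclm s) ps'.
  by move=> b; rewrite -ess'; apply: lclm_root.
have [|v ev] := @lclm_rdvd s (lclm s') ps.
  by move=> b; rewrite ess'; apply: lclm_root.
exact: (rdvd_monic_anti (lclm_monic _ _ _) (lclm_monic _ _ _) eu ev).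
Qed.

Lemma lclm_coef0 s : pindep s -> (forall b, b \in s -> b.1 != 0) ->
  (lclm s)`_0 != 0.
Proof.
elim: s => [|b s IHs] /=; first by rewrite coef1 oner_neq0.
case/andP=> y0 pis hs; rewrite skmulBl skmulXl skmulCl coefB coef_skX sub0r oppr_eq0.
rewrite coefZ !mulf_neq0 ?expf_neq0 ?hs ?mem_head // IHs // => c cs.
by rewrite hs // inE cs orbT.
Qed.

End LclmUniversal.

(** * Compatibility of products, evaluation and common multiples with ring morphisms *)

Section Naturality.

Variables (R R' : comNzRingType) (sg : {rmorphism R -> R}) (sg' : {rmorphism R' -> R'}).
Variable phi : {rmorphism R -> R'}.
Hypothesis phi_sg : forall x, phi (sg x) = sg' (phi x).

Lemma skact_nat (V : lmodType R) (V' : lmodType R') (T : V -> V) (T' : V' -> V')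
    (psi : V -> V') :
  psi 0 = 0 -> (forall u v, psi (u + v) = psi u + psi v) ->
  (forall c v, psi (c *: v) = phi c *: psi v) -> (forall v, psi (T v) = T' (psi v)) ->
  forall p v, psi (skact T p v) = skact T' (map_poly phi p) (psi v).
Proof.
move=> psi0 psiD psiZ psiT p v; rewrite (skactE _ _ (size_poly _ _)).
rewrite /skact (big_morph psi psiD psi0); apply: eq_bigr => i _.
rewrite coef_map psiZ; congr (_ *: _); elim: (i : nat) => //= n IHn.
by rewrite psiT IHn.
Qed.

Lemma map_poly_skmul p r :
  map_poly phi (skmul sg p r) = skmul sg' (map_poly phi p) (map_poly phi r).
Proof.
rewrite !skmulE; apply: (@skact_nat {poly R} {poly R'}).
- by rewrite rmorph0.
- by move=> u v; rewrite rmorphD.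
- by move=> c v; rewrite map_polyZ.
move=> v; rewrite /skX rmorphM /= map_polyX; congr (_ * _).
by apply/polyP => i; rewrite !coef_map /= phi_sg.
Qed.

Lemma skev_nat a p y : phi (skev sg a p y) = skev sg' (phi a) (map_poly phi p) (phi y).
Proof.
apply: (@skact_nat R^o R'^o); rewrite ?rmorph0 //.
- by move=> u v; rewrite rmorphD.
- by move=> c v; rewrite rmorphM.
- by move=> v; rewrite rmorphM phi_sg.
Qed.

Lemma lclm_nat q s :
  map_poly phi (lclm q sg s) = lclm q sg' [seq (phi b.1, phi b.2) | b <- s].
Proof.
elim: s => [|b s IHs] /=; first by rewrite rmorph1.
rewrite map_poly_skmul rmorphB /= map_polyX map_polyC /= IHs rmorphM rmorphXn.
by rewrite /= skev_nat IHs.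
Qed.

End Naturality.

(** * Linear independence over a domain *)

Section Minors.

Variable R : idomainType.

Lemma tofrac_num (x : {fraction R}) :
  exists2 d : R, d != 0 & exists n : R, tofrac d * x = tofrac n.
Proof.
elim/quotW: x => x; exists x.2; first exact: denom_ratioP.
exists x.1; rewrite !piE; apply/eqmodP.
rewrite /= /FracField.equivf /FracField.mulf /=.
rewrite !numden_Ratio ?mulf_neq0 ?oner_neq0 ?denom_ratioP //.
by rewrite mulr1 mul1r mulrC.
Qed.

Lemma tofrac_common_denom n (u : 'rV[{fraction R}]_n) :
  exists2 d : R, d != 0 & exists v : 'rV[R]_n, tofrac d *: u = map_mx (@tofrac R) v.
Proof.
have [d d0 dP] := fin_all_exists2 (fun i => tofrac_num (u 0 i)).
have {dP} [v vP] := fin_all_exists dP.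
exists (\prod_i d i); first by apply/prodf_neq0.
exists (\row_i (v i * \prod_(j | j != i) d j)); apply/rowP => i.
by rewrite !mxE (bigD1 i) //= !rmorphM /= mulrAC vP.
Qed.

(** Clearing denominators shows that the kernel stays trivial over the fraction field, where full
    row rank provides an invertible choice of columns. *)
Lemma left_kernel_minor r c (M : 'M[R]_(r, c)) :
  (forall v : 'rV[R]_r, v *m M = 0 -> v = 0) ->
  (r <= c)%N /\ exists f : 'I_r -> 'I_c, \det (colsub f M) != 0.
Proof.
move=> kerM; set MK := map_mx (@tofrac R) M.
have freeM : row_free MK.
  rewrite -kermx_eq0; apply/eqP/row_matrixP => i; rewrite row0.
  set u := row i _; have uM : u *m MK = 0 by rewrite -row_mul mulmx_ker row0.
  have [d d0 [v ev]] := tofrac_common_denom u.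
  have vM : v *m M = 0.
    have /matrixP vMK : map_mx (@tofrac R) (v *m M) = 0.
      by rewrite map_mxM -ev -scalemxAl uM scaler0.
    apply/matrixP => a b; have /eqP := vMK a b.
    by rewrite !mxE tofrac_eq0 => /eqP.
  move: ev; rewrite (kerM v vM) map_mx0 => /eqP.
  by rewrite scalemx_eq0 tofrac_eq0 (negPf d0) => /eqP.
split; first by rewrite -(eqP freeM) rank_leq_col.
have fullM : row_full MK^T by rewrite /row_full mxrank_tr.
exists (fullrankfun fullM); have := fullrowsub_full fullM.
rewrite row_full_unit unitmxE -trmx_mxsub det_tr -map_mxsub det_map_mx unitfE.
by rewrite tofrac_eq0.
Qed.

Lemma minor_left_kernel r c (M : 'M[R]_(r, c)) (f : 'I_r -> 'I_c) v :
  \det (colsub f M) != 0 -> v *m M = 0 -> v = 0 :> 'rV[R]_r.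
Proof.
move=> d0 vM; have vf : v *m colsub f M = 0.
  apply/rowP => j; have /rowP/(_ (f j)) := vM; rewrite !mxE => e.
  by rewrite -[RHS]e; apply: eq_bigr => i _; rewrite !mxE.
have : v *m colsub f M *m \adj (colsub f M) = 0 by rewrite vf mul0mx.
rewrite -mulmxA mul_mx_adj mul_mx_scalar => /eqP.
by rewrite scalemx_eq0 (negPf d0) => /eqP.
Qed.

Section Families.

Variable T : finType.
Implicit Types v : T -> {poly R}.

Definition lfree v := forall c : T -> R, \sum_t c t *: v t = 0 -> forall t, c t = 0.

Definition coef_mx k v : 'M[R]_(#|T|, k) := \matrix_(i, j) (v (enum_val i))`_j.

Lemma coef_mxP k v (c : T -> R) : (forall t, size (v t) <= k)%N ->
  (\row_i c (enum_val i)) *m coef_mx k v = \row_j (\sum_t c t *: v t)`_j.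
Proof.
move=> szv; apply/rowP => j; rewrite !mxE coef_sum.
rewrite (reindex (@enum_val T T)) /=; last exact/onW_bij/enum_val_bij.
by apply: eq_bigr => i _; rewrite !mxE coefZ.
Qed.

Lemma lfree_minor k v : (forall t, size (v t) <= k)%N -> lfree v ->
  (#|T| <= k)%N /\ exists f : 'I_#|T| -> 'I_k, \det (colsub f (coef_mx k v)) != 0.
Proof.
move=> szv fv; apply: left_kernel_minor => u uM; pose c t := u 0 (enum_rank t).
have eu : u = \row_i c (enum_val i) by apply/rowP => i; rewrite mxE /c enum_valK.
rewrite eu coef_mxP // in uM.
have c0 : \sum_t c t *: v t = 0.
  apply/polyP => j; rewrite coef0; have [lt_jk|le_kj] := ltnP j k.
    by have /rowP/(_ (Ordinal lt_jk)) := uM; rewrite !mxE.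
  rewrite coef_sum big1 // => t _; rewrite coefZ nth_default ?mulr0 //.
  exact: leq_trans (szv t) le_kj.
by apply/rowP => i; rewrite eu !mxE (fv c c0).
Qed.

Lemma minor_lfree k v (f : 'I_#|T| -> 'I_k) : (forall t, size (v t) <= k)%N ->
  \det (colsub f (coef_mx k v)) != 0 -> lfree v.
Proof.
move=> szv d0 c cv t.
have /rowP/(_ (enum_rank t)) : \row_i c (enum_val i) = 0 :> 'rV_#|T|.
  apply: (minor_left_kernel d0); rewrite coef_mxP // cv.
  by apply/rowP => j; rewrite !mxE coef0.
by rewrite !mxE enum_rankK.
Qed.

Lemma coef_mx_map (phi : {rmorphism R -> R}) k v :
  coef_mx k (fun t => map_poly phi (v t)) = map_mx phi (coef_mx k v).
Proof. by apply/matrixP => i j; rewrite !mxE coef_map. Qed.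

(** [phi] need not be injective: a minor whose image is nonzero was nonzero. Independence can thus
    be checked after specialisation. *)
Lemma lfree_map (phi : {rmorphism R -> R}) v :
  lfree (fun t => map_poly phi (v t)) -> lfree v.
Proof.
set k := (\max_t size (v t))%N.
have szv t : (size (v t) <= k)%N by apply: leq_bigmax.
move/(@lfree_minor k)=> [t|_ [f]]; first by rewrite (leq_trans (size_poly _ _)).
rewrite coef_mx_map -map_mxsub det_map_mx => d0; apply: (@minor_lfree k _ f) => //.
by apply: contraNneq d0 => ->; rewrite rmorph0.
Qed.

Lemma lfree_map_inj (phi : {rmorphism R -> R}) v : injective phi ->
  lfree v -> lfree (fun t => map_poly phi (v t)).
Proof.
move=> phiI; set k := (\max_t size (v t))%N.
have szv t : (size (v t) <= k)%N by apply: leq_bigmax.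
move/(@lfree_minor k)=> [|_ [f d0]] //.
apply: (@minor_lfree k _ f) => [t|]; first by rewrite (leq_trans (size_poly _ _)).
by rewrite coef_mx_map -map_mxsub det_map_mx -(rmorph0 phi) (inj_eq phiI).
Qed.

End Families.

End Minors.

(** * Independence of left multiples as linear independence of shifts *)

Section SkewIndependence.

Variables (R : idomainType) (sg : {rmorphism R -> R}) (I : finType).
Implicit Types (S : {set I}) (d : I -> nat) (f g : I -> {poly R}).

Local Notation "p ** r" := (skmul sg p r) (at level 40, left associativity).

Definition skindep S d f := forall g,
  (forall i, i \in S -> size (g i) <= d i)%N -> \sum_(i in S) g i ** f i = 0 ->
  forall i, i \in S -> g i = 0.

(** Indexes the vectors X^j f_i with i in [S] and j < d_i. The bound 0 outside [S] leaves no index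
    there. *)
Definition shift_index S d : finType := {i : I & 'I_(if i \in S then d i else 0)}.

Definition shift_at S d i (j : 'I_(if i \in S then d i else 0)) : shift_index S d :=
  Tagged (fun i => 'I_(if i \in S then d i else 0)) j.

Definition shifts S d f (t : shift_index S d) : {poly R} :=
  iter (tagged t) (skX sg) (f (tag t)).

Lemma card_shift_index S d : #|{: shift_index S d}| = (\sum_(i in S) d i)%N.
Proof.
rewrite card_tagged sumnE big_map big_enum /= [RHS]big_mkcond.
by apply: eq_bigr => i _; rewrite card_ord.
Qed.

Lemma sum_shifts S d f (c : shift_index S d -> R) (g : I -> {poly R}) :
  (forall i, i \in S -> size (g i) <= d i)%N ->
  (forall t, c t = (g (tag t))`_(tagged t)) ->
  \sum_t c t *: shifts f t = \sum_(i in S) g i ** f i.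
Proof.
move=> szg cE; transitivity (\sum_i \sum_(j < if i \in S then d i else 0%N)
   (g i)`_j *: iter j (skX sg) (f i)).
  rewrite (sig_big_dep xpredT (fun _ => xpredT)
    (fun (i : I) (j : 'I_(if i \in S then d i else 0%N)) =>
       (g i)`_j *: iter j (skX sg) (f i))) /=.
  by apply: eq_bigr => t _; rewrite cE.
rewrite [RHS]big_mkcond; apply: eq_bigr => i _; case: ifP => iS; last by rewrite big_ord0.
by rewrite (skmul_def _ _ (szg i iS)).
Qed.

Lemma skindepP S d f : skindep S d f <-> lfree (@shifts S d f).
Proof.
split=> [indf c c0 t|freef g szg g0 i iS].
  (* [insub] recovers the dependent index from a natural number; the default 0 is never reached
     below the cut-off degree. *)
  pose g i := \poly_(j < if i \in S then d i else 0%N)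
    (if insub j is Some j' then c (@shift_at S d i j') else 0).
  have cE u : c u = (g (tag u))`_(tagged u).
    case: u => i j /=; rewrite coef_poly ltn_ord.
    rewrite (insubT (fun n => (n < _)%N) (ltn_ord j)) /=.
    by congr (c (shift_at _)); apply: val_inj.
  have szg i : i \in S -> (size (g i) <= d i)%N.
    by move=> iS; apply: (leq_trans (size_poly _ _)); rewrite iS.
  rewrite (sum_shifts _ szg cE) in c0.
  have := indf g szg c0 (tag t); rewrite cE; case: t => i j /=.
  by case: ifP (j) => [_ j' ->|_ []]; rewrite ?coef0.
pose c (t : shift_index S d) := (g (tag t))`_(tagged t).
have c0 : \sum_t c t *: shifts f t = 0 by rewrite (sum_shifts _ szg).
apply/polyP => j; rewrite coef0; have [lt_jd|le_dj] := ltnP j (d i); last first.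
  by rewrite nth_default // (leq_trans (szg i iS)).
have lt_j : (j < if i \in S then d i else 0)%N by rewrite iS.
exact: (freef c c0 (shift_at (Ordinal lt_j))).
Qed.

Lemma shifts_map (phi : {rmorphism R -> R}) S d f (t : shift_index S d) :
  (forall x, phi (sg x) = sg (phi x)) ->
  map_poly phi (shifts f t) = shifts (fun i => map_poly phi (f i)) t :> {poly R}.
Proof.
move=> phi_sg; rewrite /shifts -!skmulXnl (map_poly_skmul phi_sg).
by rewrite map_polyXn.
Qed.

Lemma skindep_map (phi : {rmorphism R -> R}) S d f :
  (forall x, phi (sg x) = sg (phi x)) ->
  skindep S d (fun i => map_poly phi (f i)) -> skindep S d f.
Proof.
move=> phi_sg /skindepP fr; apply/skindepP/(lfree_map (phi := phi)) => c c0.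
by apply: fr; rewrite -[RHS]c0; apply: eq_bigr => t _; rewrite shifts_map.
Qed.

Lemma skindep_map_inj S d f : injective sg ->
  skindep S d f -> skindep S d (fun i => map_poly sg (f i)).
Proof.
move=> sgI /skindepP /(lfree_map_inj sgI) fr; apply/skindepP => c c0.
by apply: fr; rewrite -[RHS]c0; apply: eq_bigr => t _; rewrite shifts_map.
Qed.

Lemma size_iter_skX n (p : {poly R}) : (size (iter n (skX sg) p) <= n + size p)%N.
Proof.
elim: n => //= n IHn; rewrite addSn; apply: leq_trans (_ : _ <= _.+1)%N _; last exact: IHn.
apply: (leq_trans (size_polyMleq _ _)); rewrite size_polyX addn2 /=.
by rewrite ltnS size_poly.
Qed.

(** A relation between the cofactors [u i], multiplied on the right by [h], is a relation between
    the [f i]. Hence the shifts of the cofactors are independent, and they lie in the polynomials of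
    size at most [k.+1 - size h]. *)
Lemma skindep_card S d f (u : I -> {poly R}) h k : h \is monic -> (size h <= k.+1)%N ->
  (forall i, i \in S -> f i \is monic /\ f i = u i ** h) ->
  (forall i, i \in S -> size (f i) + d i <= k.+1)%N ->
  skindep S d f -> (\sum_(i in S) d i + size h <= k.+1)%N.
Proof.
move=> mh szh fE szf indf; have /skindepP indu : skindep S d u.
  move=> g szg g0; apply: indf => //.
  rewrite (eq_bigr (fun i => g i ** u i ** h)) => [|i iS].
    by rewrite -skmul_suml g0 skmul0l.
  by rewrite (fE i iS).2 skmulA.
have [|le_card _] := @lfree_minor _ _ (k.+1 - size h) _ _ indu; last first.
  by rewrite -card_shift_index -(subnK szh) leq_add2r.
case=> i j /=; rewrite /shifts /=; apply: (leq_trans (size_iter_skX _ _)).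
case: ifP j => [iS|_ []] // j; have lt_j := ltn_ord j.
have [mf ef] := fE i iS; have u0 : u i != 0.
  by apply: contraTneq mf => u0; rewrite ef u0 skmul0l monicE lead_coef0 eq_sym oner_neq0.
have [] := skmul_lead sg mh u0; rewrite -ef => esz _; have := szf i iS; rewrite esz.
have := size_poly_gt0 (u i); have := size_poly_gt0 h; rewrite u0 monic_neq0 //.
move: lt_j szh; move: (size h) (size (u i)) => a b; move: (j : nat) => j'; lia.
Qed.

End SkewIndependence.

(** * The combinatorial core *)

Section Core.

Variables (R : idomainType) (sg : {rmorphism R -> R}) (I J : finType).
Hypothesis sg_inj : injective sg.

Local Notation "p ** r" := (skmul sg p r) (at level 40, left associativity).
Local Notation skX := (skX sg).
Local Notation skindep := (skindep sg).

Lemma coef0_skmul (p r : {poly R}) : (p ** r)`_0 = p`_0 * r`_0.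
Proof.
rewrite (skmul_def _ _ (leqnSn _)) coef_sum big_ord_recl coefZ big1 ?addr0 //.
by move=> i _; rewrite coefZ lift0 iterS coef_skX mulr0.
Qed.

Lemma eq_skindep (S : {set I}) d d' (f f' : I -> {poly R}) :
  (forall i, i \in S -> d i = d' i) -> (forall i, i \in S -> f i = f' i) ->
  skindep S d f -> skindep S d' f'.
Proof.
move=> ed ef indf g szg g0; apply: indf => [i iS|]; first by rewrite ed ?szg.
by rewrite -[RHS]g0; apply: eq_bigr => i iS; rewrite ef.
Qed.

(** X f = sg(f) X, so X cancels on the right; what remains is the [sg]-image of the family,
    independent because [sg] is injective. *)
Lemma skindep_skX (S : {set I}) d (f : I -> {poly R}) :
  skindep S d f -> skindep S d (fun i => skX (f i)).
Proof.
move=> /(skindep_map_inj sg_inj) indf g szg g0; apply: indf => //.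
have e : (\sum_(i in S) g i ** map_poly sg (f i)) * 'X = 0.
  rewrite -(skmulX sg) skmul_suml -[RHS]g0; apply: eq_bigr => i _.
  by rewrite skX_map skmulA.
by apply/eqP; move/eqP: e; rewrite mulf_eq0 polyX_eq0 orbF.
Qed.

(** The combinatorial argument sees Z |-> f_Z only through these properties; [phi j] models the
    specialisation β_j = 0. *)
Variables (F : {set J} -> {poly R}) (phi : J -> {rmorphism R -> R}).
Hypotheses (F_monic : forall Z, F Z \is monic)
  (size_F : forall Z, size (F Z) = #|Z|.+1)
  (F_sub : forall W Z : {set J}, W \subset Z -> exists u, F Z = u ** F W)
  (F_coef0 : forall Z, (F Z)`_0 != 0)
  (phi_sg : forall j x, phi j (sg x) = sg (phi j x))
  (phi_in : forall (j : J) (Z : {set J}), j \in Z -> map_poly (phi j) (F Z) = skX (F (Z :\ j)))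
  (phi_out : forall (j : J) (Z : {set J}), j \notin Z -> map_poly (phi j) (F Z) = F Z).
Implicit Types (S Om : {set I}) (Z : I -> {set J}) (W : {set J}) (tau : I -> nat).

Definition FX (Z : {set J}) t := iter t skX (F Z).

Lemma FX_monic (Z : {set J}) t : FX Z t \is monic.
Proof. by have [] := iter_skX_monic sg t (F_monic Z). Qed.

Lemma size_FX (Z : {set J}) t : size (FX Z t) = (t + #|Z|).+1.
Proof. by have [_ ->] := iter_skX_monic sg t (F_monic Z); rewrite size_F addnS. Qed.

Lemma FX_sub W (Z : {set J}) t t' : W \subset Z -> (t <= t')%N ->
  exists u, FX Z t' = u ** FX W t.
Proof.
move=> sWZ le_t; have [u eu] := F_sub sWZ.
(* Moving X^t to the right past u twists its coefficients: X^t u = sg^t(u) X^t. *)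
exists ('X^(t' - t) ** iter t (map_poly sg) u).
rewrite -skmulA skmulXnl /FX -[in LHS](subnK le_t) iterD eu; congr (iter _ _ _).
by elim: t {le_t} => //= t ->; rewrite skX_mul.
Qed.

Lemma FX_phi j (Z : {set J}) t :
  map_poly (phi j) (FX Z t) = FX (Z :\ j) (t + (j \in Z)).
Proof.
rewrite /FX -skmulXnl (map_poly_skmul (phi_sg j)) map_polyXn skmulXnl.
case: (boolP (j \in Z)) => jZ; first by rewrite phi_in // addn1 iterSr.
rewrite phi_out // addn0; congr (iter _ _ (F _)); apply/setP => i.
by rewrite !inE; case: eqVneq => [->|] //=; apply: negPf.
Qed.

Definition fdim k Z tau i := (k - tau i - #|Z i|)%N.

(* Bounding all common lower bounds (W, t) is the same as bounding the
   intersection and the minimum, and is easier to transport. *)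
Definition gmcond k S Z tau := forall Om W t, Om != set0 -> Om \subset S ->
  (forall i, i \in Om -> W \subset Z i /\ (t <= tau i)%N) ->
  (\sum_(i in Om) fdim k Z tau i + #|W| + t <= k)%N.

Definition gmindep k S Z tau := skindep S (fdim k Z tau) (fun i => FX (Z i) (tau i)).

Lemma gmcond_subset k S S' Z tau : S' \subset S -> gmcond k S Z tau -> gmcond k S' Z tau.
Proof. by move=> sS c Om W t Om0 sOm; apply: c => //; apply: subset_trans sS. Qed.

(** * Replacing a tight block by a single pair *)

Section CollapseTight.

Variables (k : nat) (S : {set I}) (Z : I -> {set J}) (tau : I -> nat).
Variables (Om : {set I}) (W : {set J}) (t : nat) (i0 : I).
Hypotheses (sOm : Om \subset S) (i0Om : i0 \in Om)
  (lb : forall i, i \in Om -> W \subset Z i /\ (t <= tau i)%N).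

(** The member [i0] of the block is reused to carry the pair (W, t), so the index type stays the
    same. *)
Definition collapse_set := i0 |: (S :\: Om).
Definition collapseZ i := if i == i0 then W else Z i.
Definition collapse_tau i := if i == i0 then t else tau i.

Lemma i0_notinD : i0 \notin S :\: Om.
Proof. by rewrite inE i0Om. Qed.

(** Tightness makes the dimension of (W, t) equal to that of the whole block. A subset containing
    [i0] then inherits its bound from the original one with [i0] expanded to [Om]. *)
Lemma collapse_cond :
  (\sum_(i in Om) fdim k Z tau i + #|W| + t = k)%N ->
  gmcond k S Z tau -> gmcond k collapse_set collapseZ collapse_tau.
Proof.
move=> tight c Om' W' t' Om'0 sOm' lb'.
have dE i : i != i0 -> fdim k collapseZ collapse_tau i = fdim k Z tau i.
  by move=> ne; rewrite /fdim /collapseZ /collapse_tau (negPf ne).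
have inSD i : i \in Om' -> i != i0 -> i \in S :\: Om.
  by move=> iOm' ne; have := subsetP sOm' i iOm'; rewrite in_setU1 (negPf ne).
have [i0Om'|i0Om'] := boolP (i0 \in Om'); last first.
  have ne i : i \in Om' -> i != i0 by apply: contraTneq => ->.
  rewrite (eq_bigr (fdim k Z tau)) => [|i iOm']; last by rewrite dE ?ne.
  apply: c => // [|i iOm'].
    by apply/subsetP => i iOm'; have := inSD i iOm' (ne i iOm'); rewrite inE => /andP[].
  by have := lb' i iOm'; rewrite /collapseZ /collapse_tau (negPf (ne i iOm')).
have [sW' le_t'] : W' \subset W /\ (t' <= t)%N.
  by have := lb' i0 i0Om'; rewrite /collapseZ /collapse_tau eqxx.
have := c (Om :|: Om' :\ i0) W' t'.
have disj : [disjoint Om & Om' :\ i0].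
  rewrite disjoint_sym; apply/pred0P => i; rewrite /= !inE.
  apply/negP => /andP[/andP[ne iOm'] iOm]; have := inSD i iOm' ne.
  by rewrite inE iOm.
have -> : (\sum_(i in Om :|: Om' :\ i0) fdim k Z tau i =
    \sum_(i in Om) fdim k Z tau i + \sum_(i in Om' :\ i0) fdim k Z tau i)%N.
  by rewrite -bigU //; apply: eq_bigl => i; rewrite inE.
rewrite (big_setD1 i0 i0Om') /=.
have -> : (\sum_(i in Om' :\ i0) fdim k collapseZ collapse_tau i =
    \sum_(i in Om' :\ i0) fdim k Z tau i)%N.
  by apply: eq_bigr => i; rewrite !inE => /andP[ne _]; rewrite dE.
have -> : fdim k collapseZ collapse_tau i0 = (\sum_(i in Om) fdim k Z tau i)%N.
  have sub3 a b d : (a + b + d = k -> k - d - b = a)%N by lia.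
  by rewrite {1}/fdim /collapseZ /collapse_tau eqxx; apply: sub3.
apply.
- by apply/set0Pn; exists i0; rewrite inE i0Om.
- rewrite subUset sOm; apply/subsetP => i; rewrite !inE => /andP[ne iOm'].
  by have := inSD i iOm' ne; rewrite inE => /andP[].
move=> i; rewrite !inE => /orP[iOm|/andP[ne iOm']].
  have [sW le_t] := lb iOm; split; first exact: subset_trans sW.
  exact: leq_trans le_t.
by have := lb' i iOm'; rewrite /collapseZ /collapse_tau (negPf ne).
Qed.

(** The terms of the block add up to one left multiple G of [FX W t]. The collapsed family gives G =
    0, and the block's own independence then finishes. *)
Lemma collapse_indep : (#|W| + t < k)%N ->
  (forall i, i \in S -> #|Z i| + tau i < k)%N ->
  gmindep k collapse_set collapseZ collapse_tau -> gmindep k Om Z tau ->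
  gmindep k S Z tau.
Proof.
move=> ltW ltZ indC indOm g szg g0.
have [u uE] : exists u : I -> {poly R}, forall i, i \in Om ->
    FX (Z i) (tau i) = u i ** FX W t.
  apply: (@fin_all_exists _ (fun=> {poly R})
    (fun i w => i \in Om -> FX (Z i) (tau i) = w ** FX W t)) => i.
  have [iOm|] := boolP (i \in Om); last by exists 0.
  by have [sW le_t] := lb iOm; have [w] := FX_sub sW le_t; exists w.
pose G := \sum_(i in Om) g i ** u i.
have GE : \sum_(i in Om) g i ** FX (Z i) (tau i) = G ** FX W t.
  by rewrite skmul_suml; apply: eq_bigr => i iOm; rewrite uE // skmulA.
have sumE : G ** FX W t + \sum_(i in S :\: Om) g i ** FX (Z i) (tau i) = 0.
  rewrite -GE -[RHS]g0 [in RHS](big_setID Om) /=; congr (_ + _).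
  by apply: eq_bigl => i; rewrite inE andb_idl // => /(subsetP sOm).
(* The bound is read off the product G f, whose summands all have degree below k, because the
   divisor is monic. *)
have szG : (size G <= k - t - #|W|)%N.
  have -> : (k - t - #|W| = k.+1 - size (FX W t))%N by rewrite size_FX; lia.
  rewrite -(@size_skmul_leq _ sg) ?FX_monic //; last by lia.
  rewrite -GE; apply: (leq_trans (size_sum _ _ _)); apply/bigmax_leqP => i iOm.
  have iS := subsetP sOm i iOm; have ltZi := ltZ i iS.
  rewrite size_skmul_leq ?FX_monic //; last by lia.
  by apply: (leq_trans (szg i iS)); rewrite size_FX /fdim; lia.
pose g' i := if i == i0 then G else g i.
have neD i : i \in S :\: Om -> (i == i0) = false.
  by move=> iD; apply: contraNF i0_notinD => /eqP <-.
have g'0 i : i \in collapse_set -> g' i = 0.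
  apply: indC i => [i|].
    rewrite in_setU1 /g' /fdim /collapseZ /collapse_tau.
    case: eqVneq => //= _; rewrite inE => /andP[_ iS]; exact: szg.
  rewrite big_setU1 ?i0_notinD //= /g' /collapseZ /collapse_tau eqxx -[RHS]sumE.
  by congr (_ + _); apply: eq_bigr => i iD; rewrite neD.
move=> i iS; have [iOm|iOm] := boolP (i \in Om); last first.
  have iD : i \in S :\: Om by rewrite inE iOm.
  have := g'0 i; rewrite /g' neD //; apply; exact: setU1r.
apply: (indOm g) => // [j jOm|]; first exact/szg/(subsetP sOm).
rewrite GE; have -> : G = 0 by have := g'0 i0 (setU11 _ _); rewrite /g' eqxx.
by rewrite skmul0l.
Qed.

Lemma collapse_measure : (1 < #|Om|)%N ->
  (#|collapse_set| + \sum_(i in collapse_set) #|collapseZ i| <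
   #|S| + \sum_(i in S) #|Z i|)%N.
Proof.
move=> gt1; rewrite cardsU1 big_setU1 ?i0_notinD //= /collapseZ eqxx.
have cS : (#|S| = #|Om| + #|S :\: Om|)%N.
  by rewrite (cardsD S Om) (setIidPr sOm) subnKC ?subset_leq_card.
rewrite cS [X in (_ < _ + X)%N](big_setID Om) /= (setIidPr sOm) (big_setD1 i0 i0Om) /=.
have -> : (\sum_(i in S :\: Om) #|if i == i0 then W else Z i| = \sum_(i in S :\: Om) #|Z i|)%N.
  apply: eq_bigr => i iD; case: eqVneq => // e.
  by have /negP := i0_notinD; rewrite -e.
have := subset_leq_card (lb i0Om).1; lia.
Qed.

End CollapseTight.

(** * Setting one variable to zero *)

Section Specialize.

Variables (k : nat) (S : {set I}) (Z : I -> {set J}) (tau : I -> nat) (j : J).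

Definition specZ i := Z i :\ j.
Definition spec_tau i := (tau i + (j \in Z i))%N.

Lemma spec_fdim i : fdim k specZ spec_tau i = fdim k Z tau i.
Proof. rewrite /fdim /specZ /spec_tau [in RHS](cardsD1 j); lia. Qed.

Lemma spec_indep : gmindep k S specZ spec_tau -> gmindep k S Z tau.
Proof.
move=> ind; apply: (skindep_map (phi := phi j)) => //.
apply: eq_skindep ind => i _; first exact: spec_fdim.
by rewrite FX_phi.
Qed.

Lemma spec_measure i2 : i2 \in S -> j \in Z i2 ->
  (\sum_(i in S) #|specZ i| < \sum_(i in S) #|Z i|)%N.
Proof.
move=> i2S jZ2; rewrite !(big_setD1 i2 i2S) /= /specZ -addSn.
apply: leq_add; first by rewrite [X in (_ < X)%N](cardsD1 j) jZ2.
by apply: leq_sum => i _; apply/subset_leq_card/subD1set.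
Qed.

(** A bound t+1 on the new shifts is a bound t on the old ones, so the old condition falls short by
    at most one. Also [i1] keeps shift 0 and lies outside [Om], so [Om] is proper; a shortfall would
    make it a tight block, unless it is a singleton. *)
Lemma spec_cond i1 : i1 \in S -> tau i1 = 0%N -> j \notin Z i1 ->
  (forall i, i \in S -> #|Z i| + tau i < k)%N ->
  (forall Om W t, Om \subset S -> 1 < #|Om| < #|S| ->
    (forall i, i \in Om -> W \subset Z i /\ (t <= tau i)%N) ->
    \sum_(i in Om) fdim k Z tau i + #|W| + t != k)%N ->
  gmcond k S Z tau -> gmcond k S specZ spec_tau.
Proof.
move=> i1S tau1 jZ1 ltZ nt c Om W t Om0 sOm lb; rewrite (eq_bigr _ (fun i _ => spec_fdim i)).
have sZ i : i \in Om -> W \subset Z i.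
  by case/lb => sW _; apply: (subset_trans sW); apply: subD1set.
case: t lb => [|t] lb; first by apply: c => // i /sZ.
have lb' i : i \in Om -> W \subset Z i /\ (t <= tau i)%N.
  move=> iOm; split; first exact: sZ.
  by have [_] := lb i iOm; rewrite /spec_tau; case: (j \in Z i); lia.
have i1Om : i1 \notin Om.
  by apply/negP => /lb[_]; rewrite /spec_tau tau1 (negPf jZ1).
have ltOm : (#|Om| < #|S|)%N.
  by apply: proper_card; apply/properP; split=> //; exists i1.
have := c Om W t Om0 sOm lb'; rewrite leq_eqVlt addnS => /predU1P[e|] //.
have [gt1|le1] := ltnP 1 #|Om|; first
  by have := nt Om W t sOm; rewrite gt1 ltOm e eqxx => /(_ isT lb').
(* For a singleton the inequality is direct: |W| and the bound together do not exceed |Z_i| +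
   tau_i. *)
have /cards1P[i eOm] : #|Om| == 1%N by rewrite eqn_leq le1 card_gt0.
move: lb e; rewrite eOm big_set1 => lb; have [|sW le_t] := lb i; first by rewrite inE.
have := ltZ i; rewrite (subsetP sOm) ?eOm ?inE // => /(_ isT).
have := subset_leq_card sW; move: le_t; rewrite /fdim /specZ /spec_tau (cardsD1 j (Z i)).
by lia.
Qed.

End Specialize.

(** * Lowering the degree bound by one *)

Lemma lower_cond_pos k S Z tau : (forall i, i \in S -> 0 < tau i)%N ->
  gmcond k.+1 S Z tau -> gmcond k S Z (fun i => (tau i).-1).
Proof.
move=> tau0 c Om W t Om0 sOm lb.
have pos i : i \in Om -> (0 < tau i)%N by move=> iOm; apply/tau0/(subsetP sOm).
rewrite -ltnS -addnS; apply: leq_trans (c Om W t.+1 Om0 sOm _).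
  rewrite !leq_add2r; apply: leq_sum => i iOm; have := pos i iOm; rewrite /fdim; lia.
by move=> i iOm; have [sW le_t] := lb i iOm; split=> //; have := pos i iOm; lia.
Qed.

Section LowerDegree.

Variables (k : nat) (S : {set I}) (Z : I -> {set J}) (tau : I -> nat).
Hypothesis ltZ : forall i, i \in S -> (#|Z i| + tau i < k.+1)%N.

Local Notation tau' := (fun i => (tau i).-1).

Lemma lower_indep_pos : (forall i, i \in S -> 0 < tau i)%N ->
  gmindep k S Z tau' -> gmindep k.+1 S Z tau.
Proof.
move=> tau0 /skindep_skX ind; apply: eq_skindep ind => i iS.
  by have := tau0 i iS; rewrite /fdim; lia.
by rewrite -[in RHS](prednK (tau0 i iS)).
Qed.

Variable i1 : I.
Hypotheses (i1S : i1 \in S) (tau1 : tau i1 = 0%N)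
  (tau0 : forall i, i \in S -> i != i1 -> (0 < tau i)%N).

(** Constant terms multiply. Every term other than that of [i1] has a left-shifted factor, with zero
    constant term, while f_Z has a nonzero one. *)
Lemma const_coef0 g : \sum_(i in S) g i ** FX (Z i) (tau i) = 0 -> (g i1)`_0 = 0.
Proof.
have e : (\sum_(i in S :\ i1) g i ** FX (Z i) (tau i))`_0 = 0.
  rewrite coef_sum; apply: big1 => i; rewrite !inE => /andP[ne iS].
  by rewrite coef0_skmul -(prednK (tau0 iS ne)) /FX iterS coef_skX mulr0.
move/(congr1 (fun p : {poly R} => p`_0)); rewrite (big_setD1 i1 i1S) /= coefD e.
rewrite addr0 coef0 coef0_skmul tau1 => /eqP.
by rewrite mulf_eq0 (negPf (F_coef0 _)) orbF => /eqP.
Qed.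

Lemma drop_indep : #|Z i1| = k -> gmindep k.+1 (S :\ i1) Z tau -> gmindep k.+1 S Z tau.
Proof.
move=> cZ ind g szg g0; have g10 : g i1 = 0.
  have /size1_polyC -> : (size (g i1) <= 1)%N.
    by have := szg i1 i1S; rewrite /fdim tau1 cZ subn0 subSnn.
  by rewrite (const_coef0 g0).
move=> i iS; have [->//|ne] := eqVneq i i1; apply: (ind g); last by rewrite !inE ne.
  by move=> i'; rewrite !inE => /andP[_]; apply: szg.
by rewrite -[RHS]g0 [RHS](big_setD1 i1 i1S) /= g10 skmul0l add0r.
Qed.

(** X divides g_i1 on the right, and that factor is passed on to f_i1. Every term then involves X
    times a member of the lowered family, whose shift at [i1] stays 0 by truncation. *)
Lemma lower_indep : gmindep k S Z tau' -> gmindep k.+1 S Z tau.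
Proof.
move=> /skindep_skX ind g szg g0; have c0 := const_coef0 g0.
pose g1 := drop_poly 1 (g i1).
have eg1 : g i1 = g1 ** 'X.
  rewrite skmulX -[LHS](poly_take_drop 1) expr1 (_ : take_poly 1 _ = 0) ?add0r //.
  by apply/polyP => -[|i]; rewrite coef_take_poly coef0 //= c0.
pose g' i := if i == i1 then g1 else g i.
have g'0 i : i \in S -> g' i = 0.
  apply: ind i => [i iS|].
    rewrite /g'; case: eqVneq => [->|ne].
      by rewrite size_drop_poly; have := szg i1 i1S; rewrite /fdim tau1; lia.
    by have := szg i iS; have := tau0 iS ne; rewrite /fdim; lia.
  rewrite -[RHS]g0; apply: eq_bigr => i iS; rewrite /g'; case: eqVneq => [->|ne].
    by rewrite eg1 tau1 -skmulA skmulXl.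
  by rewrite -[in RHS](prednK (tau0 iS ne)).
move=> i iS; have := g'0 i iS; rewrite /g'; case: eqVneq => // -> e.
by rewrite eg1 e skmul0l.
Qed.

Lemma lower_cond : gmcond k.+1 S Z tau -> gmcond k S Z tau'.
Proof.
move=> c Om W t Om0 sOm lb; have [i1Om|i1Om] := boolP (i1 \in Om); last first.
  apply: (@lower_cond_pos k Om Z tau) => //; last exact: gmcond_subset c.
  by move=> i iOm; apply: tau0; [apply: (subsetP sOm) | apply: contraNneq i1Om => <-].
have t0 : t = 0%N by have [_] := lb i1 i1Om; rewrite tau1; case: (t).
rewrite t0 addn0 -ltnS;
apply: leq_trans (_ : _ <= \sum_(i in Om) fdim k.+1 Z tau i + #|W| + 0)%N _.
  (* Only the dimension at [i1] drops, by one, and this pays for passing from k+1 to k. *)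
  rewrite addn0 -addSn leq_add2r !(big_setD1 i1 i1Om) /= -addSn leq_add //.
    by rewrite /fdim tau1; have := ltZ i1S; rewrite tau1; lia.
  apply: leq_sum => i; rewrite !inE => /andP[ne iOm].
  by have := tau0 (subsetP sOm i iOm) ne; rewrite /fdim; lia.
by apply: c => // i /lb[].
Qed.

End LowerDegree.

(** * The induction, and the converse by counting dimensions *)

Definition gm_tight k S Z tau Om W t :=
  [&& Om \subset S, (1 < #|Om| < #|S|)%N,
      [forall i in Om, (W \subset Z i) && (t <= tau i)%N] &
      (\sum_(i in Om) fdim k Z tau i + #|W| + t == k)%N].

Lemma gmcond_indep k S Z tau : (forall i, i \in S -> #|Z i| + tau i < k)%N ->
  gmcond k S Z tau -> gmindep k S Z tau.
Proof.
have [N] := ubnP (k + (#|S| + \sum_(i in S) #|Z i|))%N.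
elim: N k S Z tau => // N IH k S Z tau ltN ltZ c.
have [[i0 i0S]|S0] := altP (set0Pn S); last first.
  by move=> g _ _ i; move: S0; rewrite negbK => /eqP ->; rewrite inE.
have k_gt0 : (0 < k)%N by have := ltZ i0 i0S; lia.
have [/existsP[Om /existsP[W /existsP[t]]]|] := boolP [exists Om : {set I},
    [exists W : {set J}, [exists t : 'I_k.+1, gm_tight k S Z tau Om W t]]].
  case/and4P=> sOm /andP[gt1 ltS] /forall_inP lb /eqP tight.
  have {}lb i : i \in Om -> W \subset Z i /\ (t <= tau i)%N by move/lb/andP.
  have /card_gt0P[i iOm] : (0 < #|Om|)%N by lia.
  have ltW : (#|W| + t < k)%N.
    have [sW le_t] := lb i iOm; have := ltZ i (subsetP sOm i iOm).
    by have := subset_leq_card sW; lia.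
  (* The induction hypothesis serves twice: for the collapsed family, and for the block, which is a
     proper subset of [S]. *)
  apply: (@collapse_indep k S Z tau Om W t i) => //; apply: IH.
  - by have := collapse_measure sOm iOm lb gt1; move: ltN; lia.
  - move=> i'; rewrite in_setU1 /collapseZ /collapse_tau; case: eqVneq => //= _.
    by rewrite inE => /andP[_]; apply: ltZ.
  - exact: collapse_cond.
  - rewrite (big_setID Om) /= (setIidPr sOm) in ltN; move: ltN ltS; lia.
  - by move=> i' i'Om; apply/ltZ/(subsetP sOm).
  - exact: gmcond_subset c.
move=> ntight.
have nt Om W t : Om \subset S -> (1 < #|Om| < #|S|)%N ->
    (forall i, i \in Om -> W \subset Z i /\ (t <= tau i)%N) ->
    (\sum_(i in Om) fdim k Z tau i + #|W| + t != k)%N.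
  move=> sOm szOm lb; apply: contra ntight => e.
  (* Equality forces t <= k, so the finite search over t misses no tight block. *)
  have ltt : (t < k.+1)%N by move/eqP: e => <-; rewrite ltnS leq_addl.
  apply/existsP; exists Om; apply/existsP; exists W; apply/existsP; exists (Ordinal ltt).
  by rewrite /gm_tight sOm szOm e andbT; apply/forall_inP => i /lb /andP.
have [/exists_inP[i1 i1S /eqP tau1]|] := boolP [exists i in S, tau i == 0%N]; last first.
  move/exists_inPn => tau0; have {}tau0 i : i \in S -> (0 < tau i)%N.
    by move/tau0; rewrite lt0n.
  move: ltN ltZ c; rewrite -(prednK k_gt0) => ltN ltZ c {nt ntight}.
  apply: lower_indep_pos => //; apply: IH.
  - by move: ltN; lia.
  - by move=> i iS; have := ltZ i iS; have := tau0 i iS; lia.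
  - exact: lower_cond_pos.
have [/existsP[j /andP[jZ1 /exists_inP[i2 i2S jZ2]]]|] :=
    boolP [exists j, (j \notin Z i1) && [exists i in S, j \in Z i]].
  apply: (@spec_indep k S Z tau j); apply: IH.
  - by have := spec_measure i2S jZ2; move: ltN; lia.
  - by move=> i iS; have := ltZ i iS; rewrite /specZ /spec_tau (cardsD1 j (Z i)); lia.
  - exact: (@spec_cond k S Z tau j i1).
rewrite negb_exists => /forallP sub1.
have {}sub1 i : i \in S -> Z i \subset Z i1.
  move=> iS; apply/subsetP => j jZ; have := sub1 j; apply: contraR => jZ1.
  by rewrite jZ1; apply/exists_inP; exists i.
have tau0 i : i \in S -> i != i1 -> (0 < tau i)%N.
  move=> iS ne; rewrite lt0n; apply/negP => /eqP taui.
  (* With two zero shifts and Z_i inside Z_i1, the condition for this pair reads |Z_i1| >= k, a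
     contradiction. *)
  have := c [set i; i1] (Z i) 0%N; rewrite big_setU1 ?inE //= big_set1 /fdim tau1 taui.
  have := ltZ i1 i1S; have := ltZ i iS; have := subset_leq_card (sub1 i iS).
  move=> le1 lti lti1 /(_ _ _ _).
  have -> // : [set i; i1] != set0 by apply/set0Pn; exists i; rewrite !inE eqxx.
  have -> // : [set i; i1] \subset S by rewrite subUset !sub1set iS.
  move=> /(_ isT isT) H; suff : False by [].
  have : (k - 0 - #|Z i| + (k - 0 - #|Z i1|) + #|Z i| + 0 <= k)%N; last by lia.
  by apply: H => i'; rewrite !inE => /orP[]/eqP->; rewrite ?sub1.
move: ltN ltZ c; rewrite -(prednK k_gt0) => ltN ltZ c {nt ntight}.
(* If Z_i1 has maximal size, lowering k would break the size hypothesis at [i1]; then g_i1 is a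
   constant, hence zero, and [i1] is dropped instead. *)
have [cZ|neZ] := eqVneq #|Z i1| k.-1.
  apply: (drop_indep i1S tau1) => //; apply: IH.
  - by rewrite (cardsD1 i1 S) i1S (big_setD1 i1 i1S) /= in ltN; move: ltN; lia.
  - by move=> i; rewrite !inE => /andP[_]; apply: ltZ.
  - by apply: gmcond_subset c; apply: subD1set.
apply: (lower_indep i1S tau1) => //; apply: IH.
- by move: ltN; lia.
- move=> i iS; have := ltZ i iS; have [->|ne] := eqVneq i i1.
    by rewrite tau1; move: neZ; lia.
  by have := tau0 i iS ne; lia.
- exact: (lower_cond _ i1S).
Qed.

(** Every f_i with i in [Om] is a left multiple of [FX W t], so [skindep_card] bounds the number of
    independent shifts. *)
Lemma gmindep_cond k S Z tau : (forall i, i \in S -> #|Z i| + tau i < k)%N ->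
  gmindep k S Z tau -> gmcond k S Z tau.
Proof.
move=> ltZ ind Om W t Om0 sOm lb.
have [u uE] : exists u : I -> {poly R}, forall i, i \in Om ->
    FX (Z i) (tau i) = u i ** FX W t.
  apply: (@fin_all_exists _ (fun=> {poly R})
    (fun i w => i \in Om -> FX (Z i) (tau i) = w ** FX W t)) => i.
  have [iOm|] := boolP (i \in Om); last by exists 0.
  by have [sW le_t] := lb i iOm; have [w] := FX_sub sW le_t; exists w.
have indOm : gmindep k Om Z tau.
  move=> g szg g0 i iOm; pose g' i := if i \in Om then g i else 0.
  have := ind g'; rewrite /g' => /(_ _ _ i (subsetP sOm i iOm)); rewrite iOm; apply.
    by move=> i' _; case: ifP => [/szg|_] //; rewrite size_poly0.
  rewrite (big_setID Om) /= (setIidPr sOm) [X in _ + X]big1 ?addr0 => [|i'].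
    by rewrite -[RHS]g0; apply: eq_bigr => i' ->.
  by rewrite inE => /andP[/negPf-> _]; rewrite skmul0l.
have/set0Pn[i0 i0Om] := Om0.
have := @skindep_card R sg I Om (fdim k Z tau) (fun i => FX (Z i) (tau i)) u (FX W t) k.
rewrite size_FX addnS ltnS (addnC t) addnA; apply=> //.
- exact: FX_monic.
- have [sW le_t] := lb i0 i0Om; have := ltZ i0 (subsetP sOm i0 i0Om).
  by have := subset_leq_card sW; lia.
- by move=> i iOm; rewrite FX_monic uE.
move=> i iOm; rewrite size_FX /fdim; have := ltZ i (subsetP sOm i iOm); lia.
Qed.

End Core.

(** * Generic evaluation points *)

Lemma pindep_nat (R R' : idomainType) (sg : {rmorphism R -> R})
    (sg' : {rmorphism R' -> R'}) (phi : {rmorphism R -> R'}) q s :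
  (forall x, phi (sg x) = sg' (phi x)) -> (forall x, (phi x == 0) = (x == 0)) ->
  pindep q sg' [seq (phi b.1, phi b.2) | b <- s] = pindep q sg s.
Proof.
move=> phi_sg phi0; elim: s => //= b s ->.
by rewrite -(lclm_nat phi_sg) -(skev_nat phi_sg) phi0.
Qed.

(* With constant coefficients, evaluating at the fresh variable gives a
   q-polynomial in that variable. *)
Lemma skev_polyX_neq0 (R : idomainType) (sg : {rmorphism {poly R} -> {poly R}})
    q (a : R) (f : {poly R}) : (1 < q)%N -> (forall x, sg x = x ^+ q) ->
  a != 0 -> f != 0 -> skev sg a%:P (map_poly polyC f) 'X != 0.
Proof.
move=> q_gt1 sgE a0 f0.
pose c i := iter i (fun x => a * x ^+ q) 1.
have c0 i : c i != 0 by elim: i => [|i IHi]; rewrite ?oner_neq0 //= mulf_neq0 ?expf_neq0.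
have iterE i : iter i (fun z : {poly R} => a%:P * sg z) 'X = c i *: 'X^(q ^ i)%N.
  elim: i => [|i IHi]; first by rewrite expn0 expr1 scale1r.
  by rewrite iterS IHi sgE exprZn -exprM -expnSr mul_polyC scalerA.
have sz : size (map_poly polyC f) = (size f).-1.+1.
  by rewrite size_map_polyC prednK // size_poly_gt0.
set n := (size f).-1 in sz.
(* The exponents q^i are distinct, so this coefficient receives only the leading term of [f]. *)
suff : (skev sg a%:P (map_poly polyC f) 'X)`_(q ^ n)%N != 0.
  by apply: contraNneq => ->; rewrite coef0.
rewrite /skev (skactE _ _ (eq_leq sz)) coef_sum big_ord_recr /= big1 ?add0r.
  rewrite coef_map /= iterE coefCM coefZ coefXn eqxx mulr1 mulf_neq0 //.
  by rewrite -lead_coefE lead_coef_eq0.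
move=> i _; rewrite coef_map /= iterE coefCM coefZ coefXn eqn_exp2l //.
by rewrite gtn_eqF ?mulr0.
Qed.

Section GenericPoints.

Variables (K : fieldType) (p e : nat) (charKp : p \in [pchar K]).
Variables (n : nat) (c : 'I_n -> K).
Hypothesis c_neq0 : forall j, c j != 0.

Local Notation A := {mpoly K[n]}.
Local Notation q := (p ^ e.+1)%N.

Lemma mpoly_pchar : p \in [pchar A].
Proof. exact: (rmorph_pchar (@mpolyC n K)). Qed.

Definition sgA : {rmorphism A -> A} := frobq e.+1 mpoly_pchar.

Lemma sgAE x : sgA x = x ^+ q. Proof. by []. Qed.

Lemma q_gt1 : (1 < q)%N.
Proof. by rewrite -[1%N](expn0 p) ltn_exp2l // prime_gt1 // (pcharf_prime charKp). Qed.

Lemma q_gt0 : (0 < q)%N. Proof. exact: ltnW q_gt1. Qed.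

Definition gpoint j : A * A := ((c j)%:MP, 'X_j).

(** Separates β_j as a polynomial variable over the remaining ones; coefficients are kept in [A], so
    no smaller ring is introduced. *)
Definition freshX (j : 'I_n) : {rmorphism A -> {poly A}} :=
  mmap (@polyC A \o @mpolyC n K) (fun i => if i == j then 'X else ('X_i)%:P).

Definition killX (j : 'I_n) : {rmorphism A -> A} :=
  mmap (@mpolyC n K) (fun i => if i == j then 0 else 'X_i).

Lemma freshXC j x : freshX j x%:MP = (x%:MP)%:P.
Proof. exact: mmapC. Qed.

Lemma freshXX j i : freshX j 'X_i = if i == j then 'X else ('X_i)%:P.
Proof. by rewrite /freshX /= mmapX mmap1U. Qed.

Lemma killXC j x : killX j x%:MP = x%:MP.
Proof. exact: mmapC. Qed.

Lemma killXX j i : killX j 'X_i = if i == j then 0 else 'X_i.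
Proof. by rewrite /killX /= mmapX mmap1U. Qed.

(** The multiple does not involve β_j, so [freshX j] turns its value there into a nonzero
    q-polynomial in β_j. *)
Lemma lclm_gpoint_neq0 j (s : seq 'I_n) : j \notin s ->
  skev sgA (c j)%:MP (lclm q sgA (map gpoint s)) 'X_j != 0.
Proof.
move=> js; have charP : p \in [pchar {poly A}] by rewrite pchar_poly mpoly_pchar.
pose sgP : {rmorphism {poly A} -> {poly A}} := frobq e.+1 charP.
have fr x : freshX j (sgA x) = sgP (freshX j x) by rewrite rmorphXn.
have co (x : A) : (sgA x)%:P = sgP x%:P by rewrite polyC_exp.
have eqf : map_poly (freshX j) (lclm q sgA (map gpoint s)) =
    map_poly polyC (lclm q sgA (map gpoint s)).
  rewrite (lclm_nat fr) (lclm_nat co) -!map_comp; congr (lclm _ _ _).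
  apply/eq_in_map => i si /=; rewrite freshXC freshXX.
  by case: eqVneq => // eij; rewrite -eij si in js.
suff : freshX j (skev sgA (c j)%:MP (lclm q sgA (map gpoint s)) 'X_j) != 0.
  by apply: contraNneq => ->; rewrite rmorph0.
rewrite (skev_nat fr) eqf freshXC freshXX eqxx.
by apply: (skev_polyX_neq0 q_gt1); rewrite ?mpolyC_eq0 ?c_neq0 ?monic_neq0 ?lclm_monic.
Qed.

Lemma gpoint_pindep s : uniq s -> pindep q sgA (map gpoint s).
Proof. by elim: s => //= j s IHs /andP[js us]; rewrite lclm_gpoint_neq0 // IHs. Qed.

Definition lclmZ (Z : {set 'I_n}) : {poly A} := lclm q sgA (map gpoint (enum Z)).

Lemma lclmZ_monic Z : lclmZ Z \is monic.
Proof. exact: lclm_monic. Qed.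

Lemma size_lclmZ Z : size (lclmZ Z) = #|Z|.+1.
Proof. by rewrite size_lclm size_map -cardE. Qed.

Lemma lclmZ_sub (W Z : {set 'I_n}) : W \subset Z -> exists u, lclmZ Z = skmul sgA u (lclmZ W).
Proof.
move=> sWZ; apply: lclm_rdvd; first exact: q_gt0; first exact: sgAE.
  exact/gpoint_pindep/enum_uniq.
move=> b /mapP[j jW ->]; apply: lclm_root; first exact: q_gt0; first exact: sgAE.
by apply: map_f; move: jW; rewrite !mem_enum => /(subsetP sWZ).
Qed.

Lemma lclmZ_coef0 Z : (lclmZ Z)`_0 != 0.
Proof.
apply: lclm_coef0; first exact/gpoint_pindep/enum_uniq.
by move=> b /mapP[j _ ->]; rewrite mpolyC_eq0.
Qed.

Lemma killX_sg j x : killX j (sgA x) = sgA (killX j x).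
Proof. by rewrite rmorphXn. Qed.

Lemma killX_gpoints j s : j \notin s ->
  [seq (killX j b.1, killX j b.2) | b <- map gpoint s] = map gpoint s.
Proof.
move=> js; rewrite -map_comp; apply/eq_in_map => i si /=.
by rewrite killXC killXX; case: eqVneq => // eij; rewrite -eij si in js.
Qed.

Lemma killX_out j (Z : {set 'I_n}) : j \notin Z ->
  map_poly (killX j) (lclmZ Z) = lclmZ Z.
Proof.
by move=> jZ; rewrite (lclm_nat (killX_sg j)) killX_gpoints // mem_enum.
Qed.

(** Order independence lets j be adjoined last. At β_j = 0 the value entering its linear factor
    vanishes, and as q > 1 the factor becomes X. *)
Lemma killX_in j (Z : {set 'I_n}) : j \in Z ->
  map_poly (killX j) (lclmZ Z) = skX sgA (lclmZ (Z :\ j)).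
Proof.
move=> jZ; have jD : j \notin enum (Z :\ j) by rewrite mem_enum !inE eqxx.
have -> : lclmZ Z = lclm q sgA (map gpoint (j :: enum (Z :\ j))).
  apply: lclm_perm; first exact: q_gt0; first exact: sgAE.
  - exact/gpoint_pindep/enum_uniq.
  - by apply/gpoint_pindep; rewrite cons_uniq jD enum_uniq.
  apply: eq_mem_map => i; rewrite inE !mem_enum !inE.
  by case: eqVneq => // ->; rewrite jZ.
rewrite (lclm_nat (killX_sg j)) map_cons killX_gpoints //= killXC killXX eqxx.
by rewrite skev0 expr0n subn_eq0 leqNgt q_gt1 /= mulr0 subr0 skmulXl.
Qed.

End GenericPoints.

(** * Identification of f_Z and translation of condition (ii) *)

Lemma is_fZ_lclmZ (F : finFieldType) (p e : nat) (charFp : p \in [pchar F])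
    (ns : seq nat) (a : seq F) (Z : {set 'I_(sumn ns)}) (f : {poly Rn F ns}) :
  (forall j : 'I_(sumn ns), nth 0 a (blk ns j) != 0) ->
  is_fZ (p ^ e.+1) a Z f -> f = lclmZ e charFp (fun j : 'I_(sumn ns) => nth 0 a (blk ns j)) Z.
Proof.
move=> a0; set c := fun j : 'I_(sumn ns) => _; set q := (p ^ e.+1)%N => -[].
set fK := map_poly _ f => mf dvdf lcmf.
have charK : p \in [pchar FracRn F ns].
  exact: (rmorph_pchar (@tofrac (Rn F ns)) (mpoly_pchar charFp _)).
pose sgK : {rmorphism FracRn F ns -> FracRn F ns} := frobq e.+1 charK.
have sgKE x : sgK x = x ^+ q by [].
have q0 : (0 < q)%N := q_gt0 e charFp.
have toK x : tofrac (sgA e charFp (sumn ns) x) = sgK (tofrac x) by rewrite tofracXn.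
have linE j : 'X - (tofrac (alpha q a j))%:P =
    'X - (tofrac (c j)%:MP * tofrac 'X_j ^+ (q - 1))%:P :> {poly FracRn F ns}.
  by rewrite -tofracXn -tofracM mul_mpolyC.
pose bK (j : 'I_(sumn ns)) : FracRn F ns * FracRn F ns := (tofrac (c j)%:MP, tofrac 'X_j).
have eK : map_poly (@tofrac _) (lclmZ e charFp c Z) = lclm q sgK (map bK (enum Z)).
  by rewrite (lclm_nat toK) -map_comp.
(* P-independence survives in the fraction field because the embedding reflects zero. Mutual right
   divisibility of monic polynomials then gives equality there. *)
have pK : pindep q sgK (map bK (enum Z)).
  have := pindep_nat (phi := @tofrac (Rn F ns)) q (map (gpoint c) (enum Z)) toK (@tofrac_eq0 _).
  by rewrite -map_comp => ->; apply/gpoint_pindep/enum_uniq.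
have [u eu] : exists u, fK = skmul sgK u (lclm q sgK (map bK (enum Z))).
  apply: lclm_rdvd => // b /mapP[j]; rewrite mem_enum => jZ ->.
  have [u ->] := dvdf j jZ; rewrite linE.
  by rewrite (skev_mul sgK) skev_lin ?skev0.
have [v ev] : exists v, lclm q sgK (map bK (enum Z)) = skmul sgK v fK.
  apply: lcmf => j jZ; rewrite linE; apply: (skrdvd_linP (sg := sgK)) => //.
    by rewrite tofrac_eq0 -msize_poly_eq0 msizeX.
  by apply: (@lclm_root _ _ _ _ _ _ (bK j)) => //; apply: map_f; rewrite mem_enum.
have : fK = map_poly (@tofrac _) (lclmZ e charFp c Z).
  rewrite eK; apply: (rdvd_monic_anti (sg := sgK) _ _ eu ev) => //.
  exact: lclm_monic.
move/polyP => efK; apply/polyP => i; have /eqP := efK i.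
by rewrite !coef_map /= tofrac_eq => /eqP.
Qed.

Lemma bigminn_leq (I : finType) (Om : {set I}) (tau : I -> nat) k i :
  i \in Om -> (\big[minn/k]_(i in Om) tau i <= tau i)%N.
Proof.
move=> iOm; rewrite -big_filter.
have : i \in [seq i <- index_enum I | i \in Om] by rewrite mem_filter iOm mem_index_enum.
elim: filter => //= j s IHs; rewrite inE big_cons => /predU1P[->|/IHs le_s].
  exact: geq_minl.
exact: leq_trans (geq_minr _ _) le_s.
Qed.

Lemma leq_bigminn (I : finType) (Om : {set I}) (tau : I -> nat) k t : (t <= k)%N ->
  (forall i, i \in Om -> t <= tau i)%N -> (t <= \big[minn/k]_(i in Om) tau i)%N.
Proof.
move=> le_tk le_t; elim/big_ind: _ => // x y le_x le_y.
by rewrite leq_min le_x.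
Qed.

Lemma gmcondP (I J : finType) k (Z : I -> {set J}) (tau : I -> nat) :
  (forall i, #|Z i| + tau i < k)%N ->
  gmcond k [set: I] Z tau <->
  (forall Om : {set I}, Om != set0 ->
      (\sum_(i in Om) ((k - tau i - #|Z i|)%:Z) <=
       k%:Z - (#|\bigcap_(i in Om) Z i|)%:Z - (\big[minn/k]_(i in Om) tau i)%:Z)%R).
Proof.
move=> ltZ.
have castE (Om : {set I}) : \sum_(i in Om) ((k - tau i - #|Z i|)%:Z) =
    (\sum_(i in Om) fdim k Z tau i)%N%:Z.
  by rewrite (big_morph Posz PoszD (erefl _)).
split=> [c Om Om0|c Om W t Om0 _ lb].
  rewrite castE !Num.Theory.lerBrDr -!PoszD lez_nat addnAC; apply: c => // i iOm.
  by split; [apply: bigcap_inf | apply: bigminn_leq].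
have /set0Pn[i0 i0Om] := Om0.
have := c Om Om0; rewrite castE !Num.Theory.lerBrDr -!PoszD lez_nat => le_k.
apply: leq_trans le_k; rewrite addnAC -!addnA leq_add2l leq_add //.
  (* The default value k of the minimum is harmless, since t <= tau_i0 < k. *)
  apply: leq_bigminn => [|i /lb[]//]; have [_] := lb i0 i0Om; have := ltZ i0; lia.
by apply/subset_leq_card/bigcapsP => i /lb[].
Qed.

Theorem mainTheorem2
  (q m : nat) (F : finFieldType) (ns : seq nat) (a : seq F)
  (k s : nat) (Z : 'I_s -> {set 'I_(sumn ns)}) (tau : 'I_s -> nat)
  (fZ : 'I_s -> {poly {mpoly F[sumn ns]}}) :
  prime_power q -> (0 < m)%N -> #|F| = (q ^ m)%N ->
  all (fun t => 0 < t)%N ns -> size a = size ns ->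
  (forall l, (l < size ns)%N -> nth 0 a l != 0) ->
  (forall l l', (l < size ns)%N -> (l' < size ns)%N -> l <> l' ->
      ~ sconj q (nth 0 a l) (nth 0 a l')) ->
  (1 <= s)%N -> (s <= k)%N ->
  (forall i, (#|Z i| + tau i <= k - 1)%N) ->
  (forall i, is_fZ q a (Z i) (fZ i)) ->
  let sig := fun x : {mpoly F[sumn ns]} => x ^+ q in
  let f := fun i => skmul sig 'X^(tau i) (fZ i) in
  (forall g : 'I_s -> {poly {mpoly F[sumn ns]}},
      (forall i, (size (skmul sig (g i) (f i)) <= k)%N) ->
      \sum_(i < s) skmul sig (g i) (f i) = 0 ->
      forall i, g i = 0)
  <->
  (forall Om : {set 'I_s}, Om != set0 ->
      (\sum_(i in Om) ((k - tau i - #|Z i|)%:Z) <=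
       k%:Z - (#|\bigcap_(i in Om) Z i|)%:Z - (\big[minn/k]_(i in Om) tau i)%:Z)%R).
Proof.
move=> [p [e [p_pr ->]]] m_gt0 cardF _ _ a_neq0 _ s_gt0 le_sk le_Z fZP sig f.
have k_gt0 : (0 < k)%N := leq_trans s_gt0 le_sk.
have ltZ i : (#|Z i| + tau i < k)%N by have := le_Z i; lia.
have charFp : p \in [pchar F].
  by apply: (@card_finPcharP _ p (e.+1 * m)) => //; rewrite expnM.
have blk_lt (j : 'I_(sumn ns)) : (blk ns j < size ns)%N.
  (* The last block always qualifies, its prefix sum being n; [ns] is nonempty because [j]
     exists. *)
  rewrite /blk -[X in (_ < X)%N](size_iota 0) -has_find; apply/hasP; exists (size ns).-1.
    by rewrite mem_iota /=; case: (ns) j => [|x l] [].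
  by rewrite take_oversize ?leqSpred // ltn_ord.
have c0 (j : 'I_(sumn ns)) : nth 0 a (blk ns j) != 0 by apply/a_neq0/blk_lt.
pose c (j : 'I_(sumn ns)) := nth 0 a (blk ns j).
pose sg := sgA e charFp (sumn ns); pose L := lclmZ e charFp c.
have fE i : f i = FX sg L (Z i) (tau i).
  by rewrite /f (is_fZ_lclmZ charFp c0 (fZP i)) (skmulXnl sg).
rewrite -(gmcondP ltZ).
have sg_inj : injective sg
  by apply: raddf_inj => x /eqP; rewrite expf_eq0 => /andP[_ /eqP].
have L_monic := lclmZ_monic e charFp c; have size_L := size_lclmZ e charFp c.
(* f_i is monic, so the degree bound on g_i f_i is exactly a bound on the size of g_i. *)
have dimE i (g : {poly Rn F ns}) :
    (size (skmul sig g (f i)) <= k)%N = (size g <= fdim k Z tau i)%N.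
  rewrite fE (size_skmul_leq sg) ?FX_monic // size_FX // /fdim.
  by congr (_ <= _)%N; lia.
have ltZT i : i \in [set: 'I_s] -> (#|Z i| + tau i < k)%N by [].
split=> [ind|cnd].
  apply: (gmindep_cond (sg := sg) (F := L)) => //; first exact: lclmZ_sub.
  move=> g szg g0 i _; apply: ind => [i'|]; first by rewrite dimE szg ?inE.
  by rewrite -[RHS]g0; apply: eq_big => i'; rewrite ?inE // fE.
have ind : gmindep sg L k [set: 'I_s] Z tau.
  apply: (gmcond_indep sg_inj (phi := @killX F (sumn ns))) => //.
  - exact: lclmZ_sub.
  - exact: lclmZ_coef0.
  - exact: killX_sg.
  - exact: killX_in.
  - exact: killX_out.
move=> g szg g0 i; apply: ind (in_setT i) => [i' _|]; first by rewrite -dimE.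
by rewrite -[RHS]g0; apply: eq_big => i'; rewrite ?inE // fE.
Qed.
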